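(* Given integers $0<a<b$, let $D=\gcd(a,b)$ and $$k_{a,b}=\max\left\{b\left(\frac{b-a}{D}-1\right),\ \frac{ba}{D}\right\}.$$ For any integer $j$ denote $H_j=\langle j, j+a, j+b\rangle$. Then for $j>2k_{a,b}$ the residue of $H_j$ is an integer divisible by $\dfrac{(b-a)a}{D^2}$ and $$\operatorname{res}(H_j)<\frac{8b^3}{27D^3}.$$
   Context: $\langle n_1,n_2,n_3\rangle$ denotes the submonoid of $(\mathbb{N},+)$ generated by $n_1,n_2,n_3$ (with $0\in\mathbb{N}$). A numerical semigroup $H$ is a submonoid of $\mathbb{N}$ such that $\mathbb{N}\setminus H$ is finite. For such $H$, let $M=H\setminus\{0\}$ and $PF(H)=\{f\in \mathbb{N}\setminus H: f+M\subseteq H\}$. The canonical ideal of $H$ is $\Omega_H=\{-f+h : f\in PF(H),\ h\in H\}\subset\mathbb{Z}$, the anti-canonical ideal is $\Omega_H^{-1}=\{x\in\mathbb{Z}: x+\Omega_H\subseteq H\}$, the trace is $\operatorname{tr}(H)=\Omega_H+\Omega_H^{-1}\subseteq H$, and the residue is $\operatorname{res}(H)=|H\setminus\operatorname{tr}(H)|$. For an arbitrary semigroup $H\subset\mathbb{N}$ containing $0$ (and not equal to $\{0\}$), with $d=\gcd(h:h\in H)$, one defines $\operatorname{res}(H)=\operatorname{res}\left(\frac1d H\right)$. *)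

(* Defs.v *)
From mathcomp Require Import all_boot all_order all_algebra.
From mathcomp Require Import finmap boolp classical_sets functions cardinality.

Set Implicit Arguments.
Unset Strict Implicit.
Unset Printing Implicit Defensive.

Import Order.TTheory GRing.Theory Num.Theory.

Local Open Scope classical_set_scope.
Local Open Scope nat_scope.

Definition submonoid (M : set nat) : Prop :=
  M 0 /\ forall x y, M x -> M y -> M (x + y).

Definition generated (S : set nat) : set nat := smallest submonoid S.

Definition pseudo_frobenius (H : set nat) : set nat :=
  [set f | ~ H f /\ forall m, H m -> m != 0 -> H (f + m)].

Definition canonical_ideal (H : set nat) : set int :=
  [set (- f%:Z + h%:Z)%R | f in pseudo_frobenius H & h in H].

(* The inclusion in [H] is an inclusion in Z, so the sum must be nonnegative. *)
Definition anticanonical_ideal (H : set nat) : set int :=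
  [set x | forall y, canonical_ideal H y ->
             exists2 h : nat, H h & (x + y = h%:Z)%R].

Definition trace_ideal (H : set nat) : set int :=
  [set (x + y)%R | x in canonical_ideal H & y in anticanonical_ideal H].

Definition is_gcd (H : set nat) (d : nat) : Prop :=
  (forall h, H h -> d %| h) /\
  (forall e, (forall h, H h -> e %| h) -> e %| d).

Definition set_gcd (H : set nat) : nat := xget 0 (is_gcd H).

Definition normalization (H : set nat) : set nat :=
  [set x | H (set_gcd H * x)].

Definition nontrace (H : set nat) : set nat :=
  [set h | H h /\ ~ trace_ideal H (h%:Z)%R].

(* [fset_set] is the empty set on an infinite argument: [residue H] is
   meaningful only when [nontrace (normalization H)] is finite. *)
Definition residue (H : set nat) : nat :=
  #|` fset_set (nontrace (normalization H))|.

(* The quotients are exact, and [gcdn a b <= b - a] when [0 < a < b], so the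
   truncated subtractions agree with those of Z. *)
Definition shift_bound (a b : nat) : nat :=
  maxn (b * ((b - a) %/ gcdn a b - 1)) (b * a %/ gcdn a b).

Definition shifted_semigroup (a b j : nat) : set nat :=
  generated [set j; j + a; j + b].

(* Main.v *)
Require Import Defs.
From mathcomp Require Import all_boot all_order all_algebra.
From mathcomp Require Import finmap boolp classical_sets functions cardinality.
From mathcomp Require Import zify.

(* After dividing by the gcd of the generators, put D = gcd a b, A = (b - a)/D,
   B = a/D and C = A + B = b/D. The relations between the generators n1, n2, n3
   form a lattice spanned by (A, -C, B) and a vector (u, v, -c) with
   0 <= v < C, and the bound on j forces A <= u and 2 B <= c. The Apery set of
   n1 is then an L-shaped region in the plane of the (n2, n3)-exponents. Its
   outer corners give the pseudo-Frobenius numbers: one if v = 0, two if v > 0,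
   and then they differ by v n2 - B n3. So an element of H lies outside the trace
   iff it is x n1 + y n2 + z n3 with x < A, y < min(v, C - v) and z < B; these
   representations are unique, whence res H = A B min(v, C - v) <= C^3 / 8. *)

Set Implicit Arguments.
Unset Strict Implicit.
Unset Printing Implicit Defensive.

Import Order.TTheory GRing.Theory Num.Theory.

Local Open Scope classical_set_scope.

(** * Inequalities for integer combinations of the two relations *)

Section LatticeArithmetic.
Local Open Scope ring_scope.

(* The vector tested is s (0, v, -B) + k (A, -C, B) + n (u, v, -c): a relation,
   shifted by s times the difference of the pseudo-Frobenius numbers. *)
Lemma box_escape (A B C u v c m s k n : int) :
  0 < A -> 0 < B -> 0 < m -> m <= v -> m <= C - v -> A <= u -> 2 * B <= c ->
  -1 <= s -> s <= 1 -> ~ (s = 0 /\ k = 0 /\ n = 0) ->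
  [\/ k * A + n * u <= - A, (s + n) * v - k * C <= - m
    | (k - s) * B - n * c <= - B].
Proof.
move=> A0 B0 m0 mv mC Au Bc s1 s2 nz.
case: (ltrP (- m) ((s + n) * v - k * C)) => [q|?]; last exact: Or32.
have [n0|[n0|n0]] : n <= -1 \/ n = 0 \/ 1 <= n by lia.
- apply: Or31.
  (* With [s + n <= 0], [k >= 1] would push the second entry to [-C <= -m], against [q]. *)
  have k0 : k <= 0 by rewrite leNgt; apply/negP => k1; nia.
  nia.
- have [k0|[k0|k0]] : k <= -1 \/ k = 0 \/ 1 <= k by lia.
  + by apply: Or31; rewrite n0; nia.
  + have [S|[S|S]] : s = -1 \/ s = 0 \/ s = 1 by lia.
    * by rewrite S in q; nia.
    * by lia.
    * by apply: Or33; rewrite S k0 n0; lia.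
  + have Ck : C <= k * C by nia.
    have sv : (s + n) * v <= v by rewrite n0; nia.
    exfalso; nia.
- apply: Or33.
  have k0 : k - s <= n.
    rewrite leNgt; apply/negP => k1; nia.
  nia.
Qed.

(** Used to keep [y n2 + z n3 - n1] out of the semigroup for [(y, z)] in the L-shape. The cut-off
    corner matters only at [k = n = 1]; for [n >= 2], [k <= n] the bound [2 B <= c] makes the last
    entry negative. *)
Lemma apery_escape (A B C u v c y z k n : int) :
  0 < A -> 0 < B -> 0 <= v -> v < C -> 0 < u -> 2 * B <= c ->
  y < C -> z < c -> ~ (C - v <= y /\ c - B <= z) ->
  0 < k * A + n * u -> y + n * v - k * C < 0 \/ z + k * B - n * c < 0.
Proof.
move=> A0 B0 v0 vC u0 Bc yC zc L p.
have [n0|n0] : n <= 0 \/ 1 <= n by lia.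
  have k0 : 1 <= k by nia.
  by left; nia.
have [k0|k0] : k <= 0 \/ 1 <= k by lia.
  by right; nia.
have [nk|[nk|nk]] : n < k \/ (n = 1 /\ k = 1) \/ (k <= n /\ 2 <= n) by lia.
- by left; nia.
- by case: nk => ? ?; subst; lia.
- by right; nia.
Qed.

End LatticeArithmetic.

(** * Three-generated semigroups and membership in the trace *)

Definition span3 (n1 n2 n3 : nat) : set nat :=
  [set h | exists x y z, h = x * n1 + y * n2 + z * n3].

Lemma span3_int n1 n2 n3 (h : nat) (x y z : int) :
  (0 <= x)%R -> (0 <= y)%R -> (0 <= z)%R ->
  (h%:Z = x * n1%:Z + y * n2%:Z + z * n3%:Z)%R -> span3 n1 n2 n3 h.
Proof.
move=> x0 y0 z0 E; exists `|x|%N, `|y|%N, `|z|%N; apply/eqP.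
by rewrite -eqz_nat E !PoszD !PoszM !gez0_abs.
Qed.

Lemma span3D n1 n2 n3 g h :
  span3 n1 n2 n3 g -> span3 n1 n2 n3 h -> span3 n1 n2 n3 (g + h).
Proof.
move=> [x [y [z ->]]] [x' [y' [z' ->]]].
by exists (x + x'), (y + y'), (z + z'); lia.
Qed.

Lemma span3_submonoid n1 n2 n3 : submonoid (span3 n1 n2 n3).
Proof. by split; [exists 0, 0, 0 | exact: span3D]. Qed.

(** The [H]-part of the canonical summand can be absorbed into the anti-canonical one, and by
    additivity [t + f] is anti-canonical as soon as it passes the test on the generators [-g]. *)
Lemma trace_idealP (H : set nat) (t : int) : submonoid H ->
  trace_ideal H t <->
  exists2 f, pseudo_frobenius H f & forall g, pseudo_frobenius H g ->
    exists2 h : nat, H h & (t + f%:Z - g%:Z = h%:Z)%R.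
Proof.
move=> [H0 HD]; split.
- move=> [_ [f Ff [h Hh <-]] [y Hy <-]]; exists f => // g Fg.
  have [|h' Hh' E] := Hy (- g%:Z + 0%:Z)%R; first by exists g => //; exists 0.
  by exists (h + h'); [exact: HD | lia].
- move=> [f Ff tr]; exists (- f%:Z + 0%:Z)%R; first by exists f => //; exists 0.
  exists (t + f%:Z)%R; last by lia.
  move=> _ [g Fg [h Hh <-]]; have [h' Hh' E] := tr g Fg.
  by exists (h + h'); [exact: HD | lia].
Qed.

(* (A, -C, B) and (u, v, -c) span the relations; by [hr_u] and [hr_c], A and B
   are the minimal exponents of the first and third variables in the Herzog
   matrix, so only the second one, min(v, C - v), is left undetermined. *)
Record herzog_relations (n1 n2 n3 A B C u v c : nat) : Prop := HerzogRelations {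
  hr_A : 0 < A;
  hr_B : 0 < B;
  hr_C : 1 < C;
  hr_v : v < C;
  hr_u : A <= u;
  hr_c : 2 * B <= c;
  hr_n1 : 0 < n1;
  hr_n2 : n1 <= n2;
  hr_n3 : n1 <= n3;
  hr_rel1 : A * n1 + B * n3 = C * n2;
  hr_rel2 : u * n1 + v * n2 = c * n3;
  hr_basis : forall p q r : int, (p * n1%:Z + q * n2%:Z + r * n3%:Z = 0 ->
    exists k n : int, [/\ p = k * A%:Z + n * u%:Z,
      q = n * v%:Z - k * C%:Z & r = k * B%:Z - n * c%:Z])%R }.

(** * The Apery set of [n1] and the pseudo-Frobenius numbers *)

Section Herzog.
Variables n1 n2 n3 A B C u v c : nat.
Hypothesis hr : herzog_relations n1 n2 n3 A B C u v c.
Let H := span3 n1 n2 n3.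

Lemma apery_notin f y z : y < C -> z < c -> ~ (C - v <= y /\ c - B <= z) ->
  f + n1 = y * n2 + z * n3 -> ~ H f.
Proof.
case: hr => A0 B0 C1 vC Au Bc _ _ _ _ _ basis yC zc L E [x' [y' [z' fE]]].
have [|k [n [p q r]]] := basis (x'.+1%:Z)%R (y'%:Z - y%:Z)%R (z'%:Z - z%:Z)%R.
  by rewrite fE in E; lia.
have := @apery_escape A%:Z%R B%:Z%R C%:Z%R u%:Z%R v%:Z%R c%:Z%R y%:Z%R z%:Z%R k n.
lia.
Qed.

(** The relation [(A, -C, B)], [(u, v, -c)] or their sum trades part of [(y, z)] for at least one
    [n1], which is then removed. *)
Lemma apery_in f y z :
  f + n1 = y * n2 + z * n3 -> C <= y \/ c <= z \/ (C - v <= y /\ c - B <= z) ->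
  H f.
Proof.
case: hr => A0 B0 C1 vC Au Bc _ _ _ R1 R2 _ E [h|[h|[h1 h2]]].
- apply: (@span3_int _ _ _ _ (A%:Z - 1) (y%:Z - C%:Z) (z%:Z + B%:Z))%R; lia.
- apply: (@span3_int _ _ _ _ (u%:Z - 1) (y%:Z + v%:Z) (z%:Z - c%:Z))%R; lia.
- apply: (@span3_int _ _ _ _ (u%:Z + A%:Z - 1) (y%:Z - (C%:Z - v%:Z))
    (z%:Z - (c%:Z - B%:Z)))%R; lia.
Qed.

(* The two values are (C - 1) n2 + (c - B - 1) n3 - n1 and
   (C - v - 1) n2 + (c - 1) n3 - n1, written without subtraction. *)
Lemma pseudo_frobeniusE f : pseudo_frobenius H f <->
  (0 < v /\ f + n1 + n2 + n3 + B * n3 = C * n2 + c * n3) \/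
  f + n1 + n2 + n3 + v * n2 = C * n2 + c * n3.
Proof.
have [A0 B0 C1 vC Au Bc n10 n12 n13 R1 R2 basis] := hr.
have predM k n : 0 < k -> k.-1 * n + n = k * n.
  by case: k => // k _; rewrite mulSn addnC.
have C2 := @predM C n2 ltac:(lia); have c3 := @predM c n3 ltac:(lia).
have v2 := @predM (C - v) n2 ltac:(lia).
have b3 := @predM (c - B) n3 ltac:(lia).
have vC2 : (C - v) * n2 + v * n2 = C * n2 by rewrite -mulnDl subnK //; lia.
have Bc3 : (c - B) * n3 + B * n3 = c * n3 by rewrite -mulnDl subnK //; lia.
have -> : f + n1 + n2 + n3 + B * n3 = C * n2 + c * n3 <->
    f + n1 = C.-1 * n2 + (c - B).-1 * n3 by split; lia.
have -> : f + n1 + n2 + n3 + v * n2 = C * n2 + c * n3 <->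
    f + n1 = (C - v).-1 * n2 + c.-1 * n3 by split; lia.
split.
- move=> [nHf Hf].
  have /Hf : H n1 by exists 1, 0, 0; lia.
  have /Hf : H n2 by exists 0, 1, 0; lia.
  have /Hf : H n3 by exists 0, 0, 1; lia.
  move=> /(_ ltac:(lia)) H3 /(_ ltac:(lia)) H2 /(_ ltac:(lia)) [x [y [z E]]].
  have x0 : x = 0.
    case: x E => // x E; case: nHf; exists x, y, z; lia.
  rewrite {}x0 mul0n add0n in E.
  have L : ~ (C <= y \/ c <= z \/ (C - v <= y /\ c - B <= z)).
    by move=> /(apery_in E).
  have L2 : C <= y.+1 \/ c <= z \/ (C - v <= y.+1 /\ c - B <= z).
    apply: contrapT => K; case: (@apery_notin (f + n2) y.+1 z _ _ _ _ H2); lia.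
  have L3 : C <= y \/ c <= z.+1 \/ (C - v <= y /\ c - B <= z.+1).
    apply: contrapT => K; case: (@apery_notin (f + n3) y z.+1 _ _ _ _ H3); lia.
  (* [(y, z)] is in the L-shape and both successors are outside, so it is an outer corner; for
     [v = 0] the shape is a rectangle with one corner. *)
  have [[v0 [Y Z]]|[Y Z]] : 0 < v /\ y = C.-1 /\ z = (c - B).-1 \/
                       y = (C - v).-1 /\ z = c.-1 by lia.
    by left; rewrite E Y Z.
  by right; rewrite E Y Z.
- move=> F; have [y [z [E L L2 L3]]] : exists y z, [/\ f + n1 = y * n2 + z * n3,
    ~ (C <= y \/ c <= z \/ (C - v <= y /\ c - B <= z)),
    C <= y.+1 \/ c <= z \/ (C - v <= y.+1 /\ c - B <= z) &
    C <= y \/ c <= z.+1 \/ (C - v <= y /\ c - B <= z.+1)].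
    case: F => [[v0 E]|E]; [exists C.-1, (c - B).-1 | exists (C - v).-1, c.-1];
    split=> //; lia.
  split; first by apply: apery_notin E; lia.
  move=> m [x' [y' [z' ->]]] m0.
  have {m0}[x0|[x0|x0]] : 0 < x' \/ 0 < y' \/ 0 < z'.
    by case: x' y' z' m0 => [|?] [|?] [|?] //; auto.
  + by apply: (@span3_int _ _ _ _ (x'%:Z - 1) (y%:Z + y'%:Z) (z%:Z + z'%:Z))%R; lia.
  + case: y' x0 => // y' _; have -> : f + (x' * n1 + y'.+1 * n2 + z' * n3) =
      (f + n2) + (x' * n1 + y' * n2 + z' * n3) by lia.
    apply: span3D; last by exists x', y', z'.
    by apply: (@apery_in _ y.+1 z) => //; lia.
  + case: z' x0 => // z' _; have -> : f + (x' * n1 + y' * n2 + z'.+1 * n3) =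
      (f + n3) + (x' * n1 + y' * n2 + z' * n3) by lia.
    apply: span3D; last by exists x', y', z'.
    by apply: (@apery_in _ y z.+1) => //; lia.
Qed.


(** * The box of elements outside the trace *)

Let m := minn v (C - v).

(** The difference of exponents, corrected by [s (0, v, -B)], is a relation, so [box_escape]
    applies. [s = 0] gives unique representations, [s = 1] and [s = -1] exclusion from the trace. *)
Lemma box_rep_shift (s : int) x y z x' y' z' : (-1 <= s)%R -> (s <= 1)%R ->
  x < A -> y < m -> z < B ->
  ((x' * n1 + y' * n2 + z' * n3)%:Z =
   (x * n1 + y * n2 + z * n3)%:Z + s * (v%:Z * n2%:Z - B%:Z * n3%:Z))%R ->
  [/\ s = 0%R, x = x', y = y' & z = z'].
Proof.
have [A0 B0 C1 vC Au Bc n10 n12 n13 R1 R2 basis] := hr.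
move=> s1 s2 xA ym zB E.
have [|k [n [p q r]]] := basis (x'%:Z - x%:Z)%R (y'%:Z - y%:Z - s * v%:Z)%R
  (z'%:Z - z%:Z + s * B%:Z)%R; first by lia.
have := @box_escape A%:Z%R B%:Z%R C%:Z%R u%:Z%R v%:Z%R c%:Z%R m%:Z%R s k n.
have m0 : 0 < m by lia.
have mv : m <= v by lia.
have mC : (m%:Z <= C%:Z - v%:Z)%R by lia.
have [[? [? ?]]|nz] := pselect (s = 0 /\ k = 0 /\ n = 0)%R.
  by subst; move=> _; split; lia.
by case=> //; lia.
Qed.

Lemma corner_sub :
  (exists f1, f1 + n1 + n2 + n3 + B * n3 = C * n2 + c * n3) /\
  (exists f2, f2 + n1 + n2 + n3 + v * n2 = C * n2 + c * n3).
Proof.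
have [A0 B0 C1 vC Au Bc n10 n12 n13 R1 R2 basis] := hr.
have h2 : 2 * n2 <= C * n2 by apply: leq_mul; lia.
have h3 : 2 * n3 <= c * n3 by apply: leq_mul; lia.
have hv : v.+1 * n2 <= C * n2 by apply: leq_mul; lia.
have hB : B.+1 * n3 <= c * n3 by apply: leq_mul; lia.
split.
  by exists (C * n2 + c * n3 - B * n3 - n3 - n2 - n1); lia.
by exists (C * n2 + c * n3 - v * n2 - n3 - n2 - n1); lia.
Qed.

Lemma box_notin_trace x y z : x < A -> y < m -> z < B ->
  ~ trace_ideal H (x * n1 + y * n2 + z * n3)%:Z%R.
Proof.
have [A0 B0 C1 vC Au Bc n10 n12 n13 R1 R2 basis] := hr.
move=> xA ym zB /trace_idealP[|f Ff tr]; first exact: span3_submonoid.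
have v0 : 0 < v by lia.
have [[f1 E1] [f2 E2]] := corner_sub.
(* Each corner is refuted by testing the other: [f1 - f2 = v n2 - B n3]. *)
case/pseudo_frobeniusE: Ff => [[_ E]|E].
- have [|h [x' [y' [z' ->]]] E'] := tr f2; first by apply/pseudo_frobeniusE; right.
  by have [] := @box_rep_shift 1 x y z x' y' z'; lia.
- have [|h [x' [y' [z' ->]]] E'] := tr f1; first by apply/pseudo_frobeniusE; left.
  by have [] := @box_rep_shift (-1)%R x y z x' y' z'; lia.
Qed.

Lemma notin_box_trace x y z : A <= x \/ m <= y \/ B <= z ->
  trace_ideal H (x * n1 + y * n2 + z * n3)%:Z%R.
Proof.
have [A0 B0 C1 vC Au Bc n10 n12 n13 R1 R2 basis] := hr.
move=> big; apply/trace_idealP; first exact: span3_submonoid.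
have [[f1 E1] [f2 E2]] := corner_sub.
have F2 : pseudo_frobenius H f2 by apply/pseudo_frobeniusE; right.
(* For [v = 0] there is a single pseudo-Frobenius number, and the trace is all of [H]. *)
have [v0|v0] := posnP v.
  exists f2 => // g /pseudo_frobeniusE[|]; first by lia.
  by move=> Eg; exists (x * n1 + y * n2 + z * n3); [exists x, y, z | lia].
have F1 : pseudo_frobenius H f1 by apply/pseudo_frobeniusE; left.
have in_tr (f f' x' y' z' : nat) : pseudo_frobenius H f ->
    (forall g, pseudo_frobenius H g -> g = f \/ g = f') ->
    x * n1 + y * n2 + z * n3 + f = x' * n1 + y' * n2 + z' * n3 + f' ->
    exists2 f, pseudo_frobenius H f & forall g, pseudo_frobenius H g ->
      exists2 h : nat, H h &
        ((x * n1 + y * n2 + z * n3)%:Z + f%:Z - g%:Z = h%:Z)%R.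
  move=> Ff Fg E; exists f => // g /Fg[->|->].
    by exists (x * n1 + y * n2 + z * n3); [exists x, y, z | lia].
  by exists (x' * n1 + y' * n2 + z' * n3); [exists x', y', z' | lia].
have F12 g : pseudo_frobenius H g -> g = f1 \/ g = f2.
  by move=> /pseudo_frobeniusE; lia.
have F21 g : pseudo_frobenius H g -> g = f2 \/ g = f1.
  by move=> /F12; tauto.
have [w wE] : exists w, C = v + w by exists (C - v); lia.
rewrite wE in R1 E1 E2.
(* Each large exponent pays for a shift by [f1 - f2] or [f2 - f1], directly or through
   [A n1 + B n3 = (v + w) n2]. *)
have [[x1 xE]|[[y1 yE]|[[y1 yE]|[z1 zE]]]] : (exists x1, x = x1 + A) \/
    (exists y1, y = y1 + v) \/ (exists y1, y = y1 + w) \/ exists z1, z = z1 + B.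
- have [?|[?|[?|?]]] : A <= x \/ v <= y \/ w <= y \/ B <= z by lia.
  + by left; exists (x - A); lia.
  + by right; left; exists (y - v); lia.
  + by right; right; left; exists (y - w); lia.
  + by right; right; right; exists (z - B); lia.
- by apply: (in_tr f2 f1 x1 (y + w) z) => //; rewrite xE; lia.
- by apply: (in_tr f2 f1 x y1 (z + B)) => //; rewrite yE; lia.
- by apply: (in_tr f1 f2 (x + A) y1 z) => //; rewrite yE; lia.
- by apply: (in_tr f1 f2 x (y + v) z1) => //; rewrite zE; lia.
Qed.

Let box_val (t : 'I_A * 'I_m * 'I_B) : nat :=
  t.1.1 * n1 + t.1.2 * n2 + t.2 * n3.

Lemma nontrace_box :
  nontrace H = [set` [fset box_val t | t in {: 'I_A * 'I_m * 'I_B}]%fset].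
Proof.
apply/seteqP; split=> h /=.
- case=> [[x [y [z ->]]]] ntr.
  have [xA ym zB] : [/\ x < A, y < m & z < B].
    by split; rewrite ltnNge; apply/negP => ?; apply: ntr;
      apply: notin_box_trace; auto.
  by apply/imfsetP; exists (Ordinal xA, Ordinal ym, Ordinal zB).
- case/imfsetP => -[[x y] z] /= _ ->; split; first by exists x, y, z.
  exact: box_notin_trace.
Qed.

Lemma card_nontrace : finite_set (nontrace H) /\
  #|` fset_set (nontrace H)| = A * m * B.
Proof.
rewrite nontrace_box; split; first exact: finite_fset.
rewrite set_fsetK card_imfset /=.
  by rewrite -cardE !card_prod !card_ord.
move=> [[x y] z] [[x' y'] z'] E.
have [||||||_ ? ? ?] := @box_rep_shift 0%R x y z x' y' z' => //.
  by rewrite mul0r addr0; congr Posz.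
by congr (_, _, _); apply: val_inj.
Qed.

End Herzog.

(** * The relations between shifted generators *)

Lemma solve_linear_mod B C j : coprime C B -> 0 < C ->
  exists2 v, v < C & C %| j + v * B.
Proof.
move=> cop C0; have [km kn E _] := egcdnP B C0.
(* Here [km C = kn B + 1], so [kn] is [-1/B] modulo [C]. *)
exists ((kn * j) %% C); first by rewrite ltn_mod.
rewrite -(@dvdn_addl (kn * j %/ C * C * B)); last first.
  by rewrite mulnAC dvdn_mull.
rewrite -addnA [_ * B + _]addnC -mulnDl -divn_eq.
suff -> : j + kn * j * B = j * km * C by rewrite dvdn_mull.
by move: cop; rewrite /coprime => /eqP G; rewrite G in E; nia.
Qed.

(** Imposing [u + v - c = D] on the second relation leaves [c (A + B) = j + v B], a congruence for
    [v]. The bounds on [j] give [A <= u] and [2 B <= c]. *)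
Lemma shifted_herzog_relations (A B D j : nat) :
  0 < A -> 0 < B -> 0 < D -> coprime A B -> coprime D j ->
  2 * (D * (A + B) * A.-1) < j -> 2 * (D * (A + B) * B) < j ->
  exists u v c,
    herzog_relations j (j + D * B) (j + D * (A + B)) A B (A + B) u v c.
Proof.
move=> A0 B0 D0 copAB copDj jA jB.
have copCB : coprime (A + B) B by rewrite coprime_sym /coprime gcdnDr gcdnC.
have [v vC /dvdnP[c cE]] := solve_linear_mod j copCB (ltn_addr B A0).
have cB : 2 * D * B < c.
  have : 2 * D * B * (A + B) < c * (A + B) by rewrite -cE; lia.
  by rewrite ltn_mul2r => /andP[].
have uA : A <= D + c - v.
  case: A A0 copAB jA jB cE copCB vC cB => // A _ _ /= jA _ cE _ vC _.
  case: D D0 jA {copDj} => // D _ jA.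
  suff : (A + v) * (A.+1 + B) < (D.+1 + c) * (A.+1 + B).
    by rewrite ltn_mul2r => /andP[_]; lia.
  have : v * A.+1 <= (A + B) * A.+1 by rewrite leq_mul2r; lia.
  have : (A.+1 + B) * A <= D.+1 * (A.+1 + B) * A.
    by rewrite -mulnA leq_pmull.
  have : (A.+1 + B) <= D.+1 * (A.+1 + B) by rewrite leq_pmull.
  by lia.
exists (D + c - v), v, c; split=> //; try lia; try nia.
move=> p q r E.
have EZ : ((p + q + r) * j%:Z = - (q * B%:Z + r * (A%:Z + B%:Z)) * D%:Z)%R by nia.
(* The entry sum of a relation determines [n]; coprimality of [A + B] and [B] then yields [k]. *)
have /dvdzP[n nE] : (D%:Z %| (p + q + r)%R)%Z.
  rewrite -(@Gauss_dvdzl _ _ j%:Z) ?EZ ?dvdz_mull //.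
have E2 : ((q - n * v%:Z) * B%:Z = - (r + n * c%:Z) * (A%:Z + B%:Z))%R.
  have /eqP : (D%:Z * (n * j%:Z + q * B%:Z + r * (A%:Z + B%:Z)) = 0)%R by nia.
  rewrite mulf_eq0 => /orP[/eqP|/eqP]; first by lia.
  by nia.
have /dvdzP[k kE] : ((A + B)%:Z %| (q - n * v%:Z)%R)%Z.
  rewrite -(@Gauss_dvdzl _ _ B%:Z) //.
  by rewrite E2 PoszD dvdz_mull.
have E3 : (r + n * c%:Z = - k * B%:Z)%R.
  have C0 : ((A + B)%:Z != 0)%R by lia.
  by apply: (mulIf C0); lia.
by exists (- k)%R, n; split; lia.
Qed.

(** * Passage to coprime generators, and the cubic bound *)

Lemma generated_span3 n1 n2 n3 : generated [set n1; n2; n3] = span3 n1 n2 n3.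
Proof.
apply/seteqP; split=> h.
- apply; split; first exact: span3_submonoid.
  move=> _ [[->|->]|->]; [exists 1, 0, 0|exists 0, 1, 0|exists 0, 0, 1]; lia.
- move=> [x [y [z ->]]] M [[M0 MD] SM].
  have mulM k n : M n -> M (k * n).
    by move=> Mn; elim: k => // k IH; rewrite mulSn; exact: MD.
  by apply: (MD _ _ (MD _ _ _ _)); apply: mulM; apply: SM; rewrite /=; tauto.
Qed.

Lemma set_gcdE H d : is_gcd H d -> set_gcd H = d.
Proof.
move=> Hd; rewrite /set_gcd; case: xgetP => [e _ He|/(_ d)//].
apply/eqP; rewrite eqn_dvd; case: Hd He => [dH Hd] [eH He].
by rewrite Hd // He.
Qed.

Lemma normalization_span3 d n1 n2 n3 : 0 < d -> gcdn n1 (gcdn n2 n3) = 1 ->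
  normalization (span3 (d * n1) (d * n2) (d * n3)) = span3 n1 n2 n3.
Proof.
move=> d0 cop; rewrite /normalization (@set_gcdE _ d).
- apply/seteqP; split=> h [x [y [z E]]]; exists x, y, z; last by rewrite E; lia.
  by apply/eqP; rewrite -(eqn_pmul2l d0) E; apply/eqP; lia.
- split=> [_ [x [y [z ->]]]|e eH].
    by rewrite !dvdn_add // dvdn_mull // dvdn_mulr.
  rewrite -[d]muln1 -cop !muln_gcdr !dvdn_gcd.
  by rewrite !eH //; [exists 0, 0, 1|exists 0, 1, 0|exists 1, 0, 0]; lia.
Qed.

Lemma box_card_bound A B v : 0 < A + B ->
  27 * (A * minn v (A + B - v) * B) < 8 * (A + B) ^ 3.
Proof.
move=> C0.
have [m mE] : exists m, m = minn v (A + B - v) by eexists.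
have m2 : 2 * m <= A + B by lia.
rewrite -mE.
(* This gives [8 A B m <= (A + B)^3], enough since [27 < 64]. *)
have AB4 : 4 * (A * B) <= (A + B) ^ 2 by rewrite nat_AGM2.
have : 2 * m * (4 * (A * B)) <= (A + B) * (A + B) ^ 2 by rewrite leq_mul.
have : 0 < (A + B) ^ 3 by rewrite expn_gt0 C0.
by rewrite -expnS; lia.
Qed.

Theorem corollary3p4 (a b j : nat) (a_gt0 : 0 < a) (lt_ab : a < b)
    (j_gt : 2 * shift_bound a b < j) :
  [/\ finite_set (nontrace (normalization (shifted_semigroup a b j))),
      (b - a) * a %/ gcdn a b ^ 2 %| residue (shifted_semigroup a b j) &
      ((residue (shifted_semigroup a b j))%:R
         < 8%:R * b%:R ^+ 3 / (27%:R * (gcdn a b)%:R ^+ 3) :> rat)%R].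
Proof.
set g := gcdn a b.
have g0 : 0 < g by rewrite gcdn_gt0 a_gt0.
have [B aE] : exists B, a = B * g by apply/dvdnP; rewrite dvdn_gcdl.
have [A bE] : exists A, b = (A + B) * g.
  have /dvdnP[C bE] : g %| b by rewrite dvdn_gcdr.
  by exists (C - B); rewrite subnK // -(leq_pmul2r g0) -aE -bE ltnW.
have A0 : 0 < A.
  by move: lt_ab; rewrite aE bE ltn_pmul2r // -{1}[B]add0n ltn_add2r.
have B0 : 0 < B by move: a_gt0; rewrite aE muln_gt0 => /andP[].
have copAB : coprime A B.
  have : g = gcdn A B * g
    by rewrite {1}/g aE bE -muln_gcdl gcdnDr gcdnC.
  by rewrite /coprime -(eqn_pmul2r g0) mul1n eq_sym => /eqP.
have baE : b - a = A * g by rewrite aE bE mulnDl addnK.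
have j_gt1 : 2 * ((A + B) * g * A.-1) < j.
  apply: leq_ltn_trans j_gt; rewrite /shift_bound -/g leq_mul2l /=; apply: leq_trans (leq_maxl _ _).
  by rewrite baE mulnK // bE subn1.
have j_gt2 : 2 * ((A + B) * g * B) < j.
  apply: leq_ltn_trans j_gt; rewrite /shift_bound -/g leq_mul2l /=; apply: leq_trans (leq_maxr _ _).
  by rewrite bE aE mulnA mulnK.
(* [d] is the gcd of the generators; dividing by it keeps [A] and [B] and replaces [g] by
   [D = g / d], coprime to [j']. *)
pose d := gcdn j g.
have d0 : 0 < d by rewrite gcdn_gt0 g0 orbT.
have [j' jE] : exists j', j = j' * d by apply/dvdnP; rewrite dvdn_gcdl.
have [D gE] : exists D, g = D * d by apply/dvdnP; rewrite dvdn_gcdr.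
have copDj : coprime D j'.
  have : d = gcdn D j' * d by rewrite {1}/d jE gE -muln_gcdl gcdnC.
  by rewrite /coprime -(eqn_pmul2r d0) mul1n eq_sym => /eqP.
have D0 : 0 < D by move: g0; rewrite gE muln_gt0 => /andP[].
have j_gt1' : 2 * (D * (A + B) * A.-1) < j'.
  by rewrite -(ltn_pmul2r d0) -jE; move: j_gt1; rewrite gE; lia.
have j_gt2' : 2 * (D * (A + B) * B) < j'.
  by rewrite -(ltn_pmul2r d0) -jE; move: j_gt2; rewrite gE; lia.
have -> : shifted_semigroup a b j =
    span3 (d * j') (d * (j' + D * B)) (d * (j' + D * (A + B))).
  by rewrite /shifted_semigroup generated_span3 aE bE gE jE; congr (span3 _ _ _); lia.
have cop : gcdn j' (gcdn (j' + D * B) (j' + D * (A + B))) = 1.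
  rewrite gcdnA gcdnDl gcdnAC gcdnDl gcdnAC -gcdnA -muln_gcdr gcdnDr.
  by rewrite [gcdn B A]gcdnC (eqP copAB) muln1 gcdnC; exact/eqP.
have [u [v [c hr]]] :=
  shifted_herzog_relations A0 B0 D0 copAB copDj j_gt1' j_gt2'.
have [fin card] := card_nontrace hr.
rewrite /residue normalization_span3 // card; split=> //.
  rewrite baE aE -mulnn mulnACA mulnK ?muln_gt0 ?g0 //.
  by rewrite mulnAC dvdn_mulr.
rewrite ltr_pdivlMr; last by rewrite mulr_gt0 ?exprn_gt0 ?ltr0n.
rewrite -!natrX -!natrM ltr_nat bE expnMn [8 * _]mulnA mulnA
  [_ * 27]mulnC ltn_pmul2r ?expn_gt0 ?g0 //.
by rewrite box_card_bound // addn_gt0 A0.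
Qed.
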